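(* Let $\varepsilon\in(0,1)$, let $n_1\neq n_2$ be integers with $n_1,n_2\ge 3$, and let $u_1,u_2$ be vertices of the cycles $G_1=C_{n_1}$ and $G_2=C_{n_2}$ respectively. Then $(G_1,u_1)$ and $(G_2,u_2)$ are distinguishable either by $S^{(1)}$ or by $S^{(2)}$.
   Context: $C_n$ denotes the cycle on $n$ vertices. Noisy voter model (NVM) with noise $\varepsilon\in(0,1)$ on a connected (locally finite, with at least two vertices) graph $G$: let $N_G(u)$ be the set of neighbors of $u$. At time $0$, $X_0(u)\sim\mathrm{Bern}(1/2)$ independently over all $u\in V(G)$. For every $t\ge 1$ and $u\in V(G)$, $$X_t(u)=\xi_t(u)Y_t(u)+(1-\xi_t(u))\sum_{v\in N_G(u)}I(\eta_t(u)=v)X_{t-1}(v),$$ where $\xi_t(u)\sim\mathrm{Bern}(\varepsilon)$, $Y_t(u)\sim\mathrm{Bern}(1/2)$, $\eta_t(u)$ is uniform on $N_G(u)$, and all the variables $\xi_t(u),Y_t(u),\eta_t(u)$ ($t\ge1$, $u\in V(G)$) and $X_0(u)$ ($u\in V(G)$) are independent. Write $X_t(G,u)=X_t(u)$. Distinguishability: let $(G_1,u_1),(G_2,u_2)$ be rooted graphs, both running the NVM with the same $\varepsilon$. They are distinguishable by a sequence $S=(S_t)_{t}$, where $S_t$ is a real-valued function of the observations up to time $t$ at a vertex, if there are sets $\mathcal S_1(t),\mathcal S_2(t)\subset\mathbb R$, disjoint for each $t$, such that $$\mathsf P\big[S_t(X_i(G_1,u_1),\,i\le t)\in\mathcal S_1(t),\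 S_t(X_i(G_2,u_2),\,i\le t)\in\mathcal S_2(t)\big]\to1\quad (t\to\infty).$$ Repetition statistic: for $d\in\mathbb N$ and $t>d$, $S^{(d)}_t=\frac1{t-d}\sum_{i=1}^{t-d}I(X_i(u)=X_{i+d}(u))$, where $u$ is the observed vertex, and $S^{(d)}=(S^{(d)}_t)_t$. *)

(* Defs.v *)
From HB Require Import structures.
From mathcomp Require Import all_boot all_order all_algebra finmap.
From mathcomp Require Import all_classical all_reals all_analysis.
From mathcomp Require Import zify.
Import Order.TTheory GRing.Theory Num.Theory.
Import numFieldNormedType.Exports.

Set Implicit Arguments.
Unset Strict Implicit.
Unset Printing Implicit Defensive.

Local Open Scope classical_set_scope.
Local Open Scope ring_scope.

Definition cycle_adj (n : nat) : rel 'I_n :=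
  fun i j => (j == ordS i) || (i == ordS j).

Lemma cycle_adj_sym n : symmetric (@cycle_adj n).
Proof. by move=> i j; rewrite /cycle_adj orbC. Qed.

Lemma cycle_adj_irr n : (1 < n)%N -> irreflexive (@cycle_adj n).
Proof.
move=> n1 i; rewrite /cycle_adj orbb; apply/negP => /eqP /(congr1 val) /=.
have := ltn_ord i; rewrite leq_eqVlt => /orP[/eqP e|lt].
  by rewrite e modnn => i0; move: n1; rewrite -e i0.
by rewrite modn_small // => /eqP; rewrite -[X in X == _]addn0 -addn1 eqn_add2l.
Qed.

Lemma cycle_adj_connected n (i j : 'I_n) : connect (@cycle_adj n) i j.
Proof.
have csym : connect_sym (@cycle_adj n).
  exact/sym_connect_sym/cycle_adj_sym.
have n0 : (0 < n)%N by exact: leq_ltn_trans (leq0n i) (ltn_ord i).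
suff H k (lt : (k < n)%N) : connect (@cycle_adj n) (Ordinal n0) (Ordinal lt).
  have E (l : 'I_n) : connect (@cycle_adj n) (Ordinal n0) l.
    by case: l => l lt; exact: H.
  by apply: (connect_trans _ (E j)); rewrite csym; exact: E.
elim: k lt => [|k IH] lt; first by rewrite (_ : Ordinal lt = Ordinal n0) //;
  exact: val_inj.
apply: (connect_trans (IH (ltnW lt))); apply: connect1; apply/orP; left.
by apply/eqP/val_inj; rewrite /= modn_small.
Qed.

Lemma cycle_adj_degree n (i : 'I_n) : (2 < n)%N -> #|cycle_adj i| = 2.
Proof.
move=> n2.
have -> : #|cycle_adj i| = #|[set ordS i; ord_pred i]%SET|.
  apply: eq_card => j; rewrite !inE /in_mem /= /cycle_adj; congr (_ || _).
  by apply/eqP/eqP => ->; rewrite ?ordSK ?ord_predK.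
rewrite cards2; case: eqP => // /(congr1 (@ordS n)); rewrite ord_predK.
move=> /(congr1 val) /=; rewrite -[(_ %% n).+1]addn1 modnDml addn1.
have lt := ltn_ord i; have [lt2|le2] := ltnP i.+2 n; first by rewrite modn_small //; lia.
by rewrite -(subnK le2) modnDr modn_small; lia.
Qed.

(* The classes F i of events are independent: every finite choice of events,
   at most one from each class, satisfies the product rule. *)
Definition mutually_independent (R : realType) d (T : measurableType d)
    (P : probability T R) (I : choiceType) (F : I -> set (set T)) : Prop :=
  forall (J : {fset I}) (A : I -> set T),
    (forall i, i \in J -> F i (A i)) ->
    P (\bigcap_(i in [set` J]) A i) = (\prod_(i <- J) P (A i))%E.

(* Events determined by a discrete random variable X. *)
Definition events_of d (T : measurableType d) (V : Type) (X : T -> V) :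
  set (set T) := range (preimage X).

(* Randomness driving the noisy voter model with noise eps on the finite graph
   with adjacency relation e. In xi, Y and eta, the index t : nat stands for
   time t + 1, so that only the variables of times >= 1 are present. *)
Record nvm (R : realType) (eps : R) (V : finType) (e : rel V)
    d (T : measurableType d) (P : probability T R) := NVM {
  nvm_X0 : V -> {RV P >-> bool};
  nvm_xi : nat -> V -> {RV P >-> bool};
  nvm_Y : nat -> V -> {RV P >-> bool};
  nvm_eta : nat -> V -> T -> V;
  nvm_X0_law : forall u, distribution P (nvm_X0 u) =1 bernoulli_prob (2^-1 : R);
  nvm_xi_law : forall t u, distribution P (nvm_xi t u) =1 bernoulli_prob eps;
  nvm_Y_law : forall t u, distribution P (nvm_Y t u) =1 bernoulli_prob (2^-1 : R);
  nvm_eta_measurable : forall t u v, measurable (nvm_eta t u @^-1` [set v]);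
  nvm_eta_law : forall t u v, P (nvm_eta t u @^-1` [set v]) =
    (if e u v then (#|e u|%:R)^-1 else 0)%:E;
  nvm_indep : mutually_independent P
    (fun i : V + (nat * V + (nat * V + nat * V)) =>
      match i with
      | inl u => events_of (nvm_X0 u)
      | inr (inl (t, u)) => events_of (nvm_xi t u)
      | inr (inr (inl (t, u))) => events_of (nvm_Y t u)
      | inr (inr (inr (t, u))) => events_of (nvm_eta t u)
      end) }.

Fixpoint nvm_state (R : realType) (eps : R) (V : finType) (e : rel V)
    d (T : measurableType d) (P : probability T R) (M : nvm eps e P)
    (t : nat) (u : V) (w : T) : R :=
  match t with
  | 0%N => (nvm_X0 M u w)%:R
  | s.+1 =>
      (nvm_xi M s u w)%:R * (nvm_Y M s u w)%:R
      + (1 - (nvm_xi M s u w)%:R)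
        * \sum_(v | e u v) (nvm_eta M s u w == v)%:R * nvm_state M s v w
  end.

Definition nvm_obs (R : realType) (eps : R) (V : finType) (e : rel V)
    d (T : measurableType d) (P : probability T R) (M : nvm eps e P)
    (u : V) (t : nat) (w : T) : t.+1.-tuple R :=
  [tuple nvm_state M i u w | i < t.+1].

(* A statistic S t is a function of the observations at times 0, ..., t. *)
Definition statistic (R : realType) := forall t : nat, t.+1.-tuple R -> R.

(* The joint law of the two models is not prescribed: the sets Q1 and Q2 depend
   only on the rooted graphs and on eps, and the convergence is required for
   any two models defined on a common probability space. *)
Definition distinguishable (R : realType) (eps : R)
    (V1 : finType) (e1 : rel V1) (u1 : V1) (V2 : finType) (e2 : rel V2) (u2 : V2)
    (S : statistic R) : Prop :=
  exists Q1 Q2 : nat -> set R,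
    (forall t, Q1 t `&` Q2 t = set0) /\
    forall (d : measure_display) (T : measurableType d) (P : probability T R)
      (M1 : nvm eps e1 P) (M2 : nvm eps e2 P),
      (fun t => P [set w | Q1 t (S t (nvm_obs M1 u1 t w)) /\
                           Q2 t (S t (nvm_obs M2 u2 t w))]) @ \oo --> 1%E.

(* The value at times t <= d is the junk value 0. *)
Definition repetition_stat (R : realType) (k : nat) : statistic R :=
  fun t x => (t - k)%:R^-1 * \sum_(1 <= i < (t - k).+1) (x`_i == x`_(i + k))%:R.

(* Main.v *)
(* Write Z_t = 2 X_t - 1 and q = (1 - eps)^2.  Conditionally on the past, a
   site copies a uniform neighbour with probability 1 - eps and is centred
   otherwise, so the covariances of the Z_t at two distinct sites are averaged
   over both neighbourhoods and multiplied by q at each step.  Hence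
   E[f Z_t(u) Z_t(v)] - E[f] K(u, v) is O(q^(t - s)) for every bounded f that
   depends on the times up to s only, where K is the stationary covariance.
   With f = 1 this gives the limits of P(X_i(u) = X_(i+d)(u)); with
   f = Z_i Z_(i+d) - c it gives exponentially decaying correlations, and the
   repetition statistic concentrates by Chebyshev's inequality.

   On the n-cycle, K(u, u + 2j) = (l^j + l^(m-j)) / (1 + l^m), where
   l + 1/l + 2 = 4/q and m = n for odd n, m = n/2 for even n; for even n,
   sites at odd distance are uncorrelated.  Lag 1 sees K at distance 1, which
   vanishes exactly when n is even.  Lag 2 sees K at distance 2, which
   determines m, hence n among the cycles of the same parity. *)
Require Import Defs.
From mathcomp Require Import all_boot all_order all_algebra finmap.
From mathcomp Require Import all_classical all_reals all_analysis.
From mathcomp Require Import zify ring lra.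
Import Order.TTheory GRing.Theory Num.Theory.
Import numFieldNormedType.Exports.
Local Open Scope classical_set_scope.
Local Open Scope ring_scope.

Set Implicit Arguments.
Unset Strict Implicit.
Unset Printing Implicit Defensive.

(** * Functions of finitely many independent discrete variables *)
Section Determined.
Context (I : choiceType) (D : finType) (T : Type) (val : I -> T -> D).

(** [f] depends on finitely many of the variables, all with index in [p]. This stands in for
    measurability with respect to the sigma-algebra they generate: [D] being finite, such an [f]
    takes finitely many values. *)
Definition determined (A : Type) (p : pred I) (f : T -> A) : Prop :=
  exists2 J : {fset I}, {in J, forall i, p i} &
    forall w w', {in J, forall i, val i w = val i w'} -> f w = f w'.

Lemma determined_cst A p (a : A) : determined p (fun=> a).
Proof. by exists fset0. Qed.

Lemma determined_var (p : pred I) i : p i -> determined p (val i).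
Proof.
move=> pi; exists [fset i]%fset; first by move=> j; rewrite inE => /eqP ->.
by move=> w w'; apply; rewrite inE.
Qed.

Lemma determined_comp A B p (h : A -> B) (f : T -> A) :
  determined p f -> determined p (fun w => h (f w)).
Proof. by move=> [J pJ fJ]; exists J => // w w' /fJ ->. Qed.

Lemma determined_comp2 A B C p (h : A -> B -> C) f g :
  determined p f -> determined p g -> determined p (fun w => h (f w) (g w)).
Proof.
move=> [J pJ fJ] [K pK gK]; exists (J `|` K)%fset.
  by move=> i; rewrite inE => /orP[/pJ|/pK].
move=> w w' eqw; congr h; [apply: fJ | apply: gK] => i iJ; apply: eqw.
  by rewrite inE iJ.
by rewrite inE iJ orbT.
Qed.

Lemma determined_sub A (p p' : pred I) (f : T -> A) :
  {subset p <= p'} -> determined p f -> determined p' f.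
Proof. by move=> pp' [J pJ fJ]; exists J => // i /pJ /pp'. Qed.

Lemma determined_sum (R : nmodType) p (X : Type) (r : seq X) (q : pred X)
    (F : X -> T -> R) :
  (forall x, determined p (F x)) ->
  determined p (fun w => \sum_(x <- r | q x) F x w).
Proof.
move=> dF; elim: r => [|x r IH].
  under eq_fun do rewrite big_nil; exact: determined_cst.
under eq_fun do rewrite big_cons -[X in if _ then _ else X]add0r -(fun_if (+%R^~ _)).
apply: (determined_comp2 +%R) IH.
by case: (q x) => //; exact: determined_cst.
Qed.

Definition readout (J : {fset I}) (w : T) : {ffun J -> D} :=
  [ffun j => val (fsval j) w].

Lemma readoutP J w w' :
  readout J w = readout J w' <-> {in J, forall i, val i w = val i w'}.
Proof.
split=> [/ffunP eqw i iJ|eqw]; first by have := eqw [` iJ]%fset; rewrite !ffunE.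
by apply/ffunP => j; rewrite !ffunE; apply: eqw; exact: fsvalP.
Qed.

(** Choosing a preimage outcome for each realised vector defines [F]; [a0] is its value at vectors
    that no outcome realises. *)
Lemma determined_readout A (a0 : A) (J : {fset I}) (f : T -> A) :
  (forall w w', {in J, forall i, val i w = val i w'} -> f w = f w') ->
  exists F : {ffun J -> D} -> A, f = F \o readout J.
Proof.
move=> fJ.
exists (fun a => if pselect (exists w, readout J w = a) is left e
                 then f (projT1 (cid e)) else a0).
apply/funext => w /=; case: pselect => [e|[]]; last by exists w.
by case: cid => w' /= /readoutP /fJ.
Qed.

(** Quantifying over the proof of [i \in J] makes each event meaningful for every index of [I], the
    form in which the product rule takes its events. *)
Lemma readout_preimage (J : {fset I}) (a : {ffun J -> D}) :
  readout J @^-1` [set a] =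
  \bigcap_(i in [set` J])
    (val i @^-1` [set x | forall iJ : i \in J, x = a [` iJ]%fset]).
Proof.
apply/seteqP; split=> w /=.
  by move=> <- i /= iJ iJ'; rewrite ffunE.
by move=> wa; apply/ffunP => j; rewrite ffunE (wa _ (fsvalP j) (fsvalP j)) fsetsubE.
Qed.

End Determined.

(** * Expectations, second moments and independence *)

Section Expectation.
Context (R : realType) d (T : measurableType d) (P : probability T R).
Context (I : choiceType) (D : finType) (val : I -> T -> D).
Hypothesis val_measurable : forall i x, measurable (val i @^-1` [set x]).

Local Notation det := (determined val).
Local Notation "''E' f" := (Rintegral P setT f) (at level 10, f at level 8).

Lemma readout_measurable (J : {fset I}) (A : set {ffun J -> D}) :
  measurable (readout val J @^-1` A).
Proof.
have finm (X : finType) (g : T -> X) (B : set X) :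
    (forall x, measurable (g @^-1` [set x])) -> measurable (g @^-1` B).
  move=> mg; rewrite -[B]image_id -bigcup_imset1 preimage_bigcup.
  by apply: fin_bigcup_measurable => //; exact: finite_finset.
apply: (finm) => a; rewrite readout_preimage.
apply: fin_bigcap_measurable => // i iJ; exact: finm.
Qed.

Lemma determined_measurable p (Q : T -> Prop) : det p Q -> measurable [set w | Q w].
Proof.
by move=> [J _ /(determined_readout True)[F ->]]; exact: (readout_measurable F).
Qed.

Lemma determined_integrable p (f : T -> R) : det p f ->
  P.-integrable setT (EFin \o f).
Proof.
move=> [J _ /(determined_readout 0)[F ->]].
apply: measurable_bounded_integrable => //.
- by rewrite (le_lt_trans (probability_le1 P _))// ltry.
- by move=> _ Y mY; rewrite setTI comp_preimage; exact: readout_measurable.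
(* [F] has a finite domain, so the sum of all its absolute values is a uniform bound. *)
- exists (\sum_a `|F a|); split; first exact: num_real.
  move=> M ltM w _; apply: le_trans (ltW ltM).
  rewrite (bigD1 (readout val J w))//=.
  by rewrite lerDl sumr_ge0.
Qed.

Lemma expectD p p' f g : det p f -> det p' g ->
  'E (fun w => f w + g w) = 'E f + 'E g.
Proof. by move=> df dg; apply: RintegralD (determined_integrable df) (determined_integrable dg). Qed.

Lemma expectB p p' f g : det p f -> det p' g ->
  'E (fun w => f w - g w) = 'E f - 'E g.
Proof. by move=> df dg; apply: RintegralB (determined_integrable df) (determined_integrable dg). Qed.

Lemma expectZ p k f : det p f -> 'E (fun w => k * f w) = k * 'E f.
Proof. by move=> df; apply: RintegralZl (determined_integrable df). Qed.

Lemma expect_sum p (X : Type) (r : seq X) (q : pred X) (F : X -> T -> R) :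
  (forall x, det p (F x)) ->
  'E (fun w => \sum_(x <- r | q x) F x w) = \sum_(x <- r | q x) 'E (F x).
Proof.
move=> dF; elim: r => [|x r IH].
  rewrite big_nil; under eq_Rintegral do rewrite big_nil.
  by rewrite Rintegral_cst// mul0r.
rewrite big_cons; case: ifP => qx; under eq_Rintegral do rewrite big_cons qx.
  by rewrite (expectD (dF x) (determined_sum _ _ dF)) IH.
exact: IH.
Qed.

Lemma expect_le p p' f g : det p f -> det p' g -> (forall w, f w <= g w) ->
  'E f <= 'E g.
Proof.
move=> df dg fg.
exact: le_Rintegral (determined_integrable df) (determined_integrable dg) _.
Qed.

Lemma expect_cst k : 'E (fun=> k) = k.
Proof. by rewrite Rintegral_cst//= probability_setT mulr1. Qed.

Lemma expect_abs_le p f B : det p f -> (forall w, `|f w| <= B) -> `|'E f| <= B.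
Proof.
move=> df fB; have c k := determined_cst val p (k : R).
rewrite ler_norml -(expect_cst (- B)) -{2}(expect_cst B).
by apply/andP; split; [apply: expect_le (c _) df _|apply: expect_le df (c _) _] => w;
  have := fB w; rewrite ler_norml => /andP[].
Qed.

Lemma expect_indic (A : set T) : measurable A -> 'E (\1_A) = fine (P A).
Proof. by move=> mA; rewrite /Rintegral integral_indic// setIT. Qed.

Lemma chebyshev_determined p (f : T -> R) (a : R) : det p f -> 0 < a ->
  (P [set w | (a <= `|f w|)%R] <= ('E (fun w => f w ^+ 2) / a ^+ 2)%:E)%E.
Proof.
move=> df a0.
have mA : measurable [set w | a <= `|f w|].
  apply: (@determined_measurable p (fun w => a <= `|f w|)).
  exact: (determined_comp (fun x => is_true (a <= `|x|))).
rewrite -[leLHS]fineK ?fin_num_measure// lee_fin -expect_indic// mulrC.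
have df2 : det p (fun w => f w ^+ 2) by exact: (determined_comp (fun x => x ^+ 2)).
rewrite -(expectZ _ df2); apply: (@expect_le p p).
- rewrite (_ : \1_[set w | a <= `|f w| ] = fun w => (a <= `|f w|)%R%:R); last first.
    by apply/funext => w; rewrite indicE; congr ((nat_of_bool _)%:R); apply/idP/idP; rewrite inE.
  exact: (determined_comp (fun x => (a <= `|x|)%R%:R)).
- exact: (determined_comp (fun x => a ^- 2 * x ^+ 2) df).
- move=> w; rewrite indicE mulrC; case: (boolP (w \in _)) => [|_]; last first.
    by rewrite divr_ge0 ?sqr_ge0.
  rewrite inE => /= aw; rewrite ler_pdivlMr ?exprn_gt0// mul1r.
  by rewrite -[leRHS]real_normK ?num_real// lerXn2r// nnegrE ltW.
Qed.

(** Induction on [N]: the new term [W N.+1] adds its own second moment, at most [C], and twice its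
    covariances with the earlier terms, at most [2 * C / (1 - q)] by a geometric series. The second
    moment thus grows only linearly. *)
Lemma second_moment_sum p (W : nat -> T -> R) (C q : R) N : 0 <= C -> 0 <= q < 1 ->
  (forall i, det p (W i)) ->
  (forall i j, (i <= j)%N -> `|'E (fun w => W i w * W j w)| <= C * q ^+ (j - i)) ->
  'E (fun w => (\sum_(1 <= i < N.+1) W i w) ^+ 2) <= N%:R * (C * (1 + 2 / (1 - q))).
Proof.
move=> C0 /andP[q0 q1] dW covW.
have geo n : \sum_(1 <= i < n.+1) q ^+ (n.+1 - i) <= 1 / (1 - q).
  have q1_neq0 : 1 - q != 0 by rewrite subr_eq0 gt_eqF.
  have -> : \sum_(1 <= i < n.+1) q ^+ (n.+1 - i) = q * (1 - q ^+ n) / (1 - q).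
    elim: n => [|n IH]; first by rewrite big_geq// subrr mulr0 mul0r.
    rewrite big_nat_recr//= subSn// subnn expr1.
    under eq_big_nat => i /andP[_ i_le].
      rewrite subSn; last by rewrite ltnW.
      rewrite exprS; over.
    by rewrite -mulr_sumr IH exprS; field.
  rewrite ler_pM2r ?invr_gt0 ?subr_gt0// mulr_ile1// ?(ltW q1)//.
    by rewrite subr_ge0 exprn_ile1// ltW.
  by rewrite gerBl exprn_ge0.
elim: N => [|N IH].
  rewrite mul0r; under eq_Rintegral do rewrite big_geq// expr0n/=.
  by rewrite expect_cst.
pose S n w := \sum_(1 <= i < n.+1) W i w.
have dS n : det p (S n) by exact: determined_sum.
have dS2 : det p (fun w => S N w ^+ 2) by exact: (determined_comp (fun x => x ^+ 2)).
have dWW i j : det p (fun w => W i w * W j w) by exact: (determined_comp2 *%R).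
have dSW : det p (fun w => \sum_(1 <= i < N.+1) W i w * W N.+1 w).
  exact: determined_sum.
have d2SW := determined_comp ( *%R 2) dSW.
have -> : (fun w => (\sum_(1 <= i < N.+2) W i w) ^+ 2) = (fun w =>
    S N w ^+ 2 + (2 * (\sum_(1 <= i < N.+1) W i w * W N.+1 w) + W N.+1 w * W N.+1 w)).
  apply/funext => w; rewrite big_nat_recr//= -mulr_suml -/(S N w); ring.
rewrite (expectD dS2 (determined_comp2 +%R d2SW (dWW _ _))).
rewrite (expectD d2SW (dWW _ _)) (expectZ _ dSW) (expect_sum _ _ (fun i => dWW i N.+1)).
rewrite -[N.+1%:R]natr1 (mulrDl N%:R) mul1r; apply: lerD; first exact: IH.
rewrite [leRHS](_ : _ = 2 * (C * (1 / (1 - q))) + C); last by ring.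
apply: lerD.
  rewrite ler_pM2l//; apply: le_trans (ler_wpM2l C0 (geo N)).
  rewrite mulr_sumr; apply: ler_sum_nat => i /andP[_ iN].
  by apply: le_trans (ler_norm _) (covW _ _ _); rewrite ltnW.
by have := covW N.+1 N.+1 (leqnn _); rewrite subnn expr0 mulr1; apply/le_trans/ler_norm.
Qed.

Hypothesis val_independent :
  mutually_independent P (fun i => events_of (val i)).

Lemma independent_readout (J : {fset I}) (a : {ffun J -> D}) i x : i \notin J ->
  P (readout val J @^-1` [set a] `&` val i @^-1` [set x]) =
  (P (readout val J @^-1` [set a]) * P (val i @^-1` [set x]))%E.
Proof.
move=> iJ.
(* One family of events serves both [J] and [J] with [i] added, so that the product rule can be
   applied to each and the results compared. *)
pose A j := val j @^-1` [set y | if j == i then y = x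
                              else forall jJ : j \in J, y = a [` jJ]%fset].
have AJ : readout val J @^-1` [set a] = \bigcap_(j in [set` J]) A j.
  rewrite readout_preimage; apply: eq_bigcapr => j /= jJ; rewrite /A.
  by case: eqP => // ji; rewrite -ji (jJ : j \in J) in iJ.
have Ai : val i @^-1` [set x] = A i by rewrite /A eqxx.
have Aev (K : {fset I}) j : j \in K -> events_of (val j) (A j).
  by move=> _; exists [set y | if j == i then y = x
     else forall jJ : j \in J, y = a [` jJ]%fset].
have -> : readout val J @^-1` [set a] `&` val i @^-1` [set x] =
    \bigcap_(j in [set` (i |` J)%fset]) A j.
  rewrite AJ Ai; apply/seteqP; split=> w /=.
    by move=> [wJ wi] j /=; rewrite !inE => /orP[/eqP ->//|/wJ].
  move=> wA; split=> [j jJ|]; apply: wA; rewrite /= !inE ?eqxx//.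
  by rewrite [j \in J]jJ orbT.
rewrite (val_independent (Aev _)) big_fsetU1//= muleC AJ Ai.
by rewrite (val_independent (Aev _)).
Qed.

(** Write [f] as a combination of indicators of the values of its readout; each indicator is
    independent of variable [i], which lies outside the readout. *)
Lemma expect_indep p f i x : det p f -> ~~ p i ->
  'E (fun w => f w * (val i w == x)%:R) =
  'E f * fine (P (val i @^-1` [set x])).
Proof.
move=> [J pJ /(determined_readout 0)[F ->]] pi.
have iJ : i \notin J by apply: contraNN pi => /pJ.
have Hrd (a : {ffun J -> D}) : det predT (fun w => (readout val J w == a)%:R : R).
  by exists J => // w w' /readoutP ->.
have Hi : det predT (fun w => (val i w == x)%:R : R).
  by apply: (determined_comp (fun y => (y == x)%:R)); exact: determined_var.
have -> : F \o readout val J =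
    (fun w => \sum_a F a * (readout val J w == a)%:R).
  apply/funext => w /=.
  rewrite (bigD1 (readout val J w))//= eqxx mulr1 big1 ?addr0// => a.
  by rewrite eq_sym => /negPf ->; rewrite mulr0.
have fin A : measurable A -> P A \is a fin_num by move=> mA; exact: fin_num_measure.
under eq_Rintegral do rewrite mulr_suml.
rewrite (expect_sum _ _ (p := predT)); last first.
  move=> a; apply: (determined_comp2 *%R) => //.
  by apply: determined_comp.
rewrite (expect_sum _ _ (p := predT)); last by move=> a; apply: determined_comp.
rewrite mulr_suml; apply: eq_bigr => a _.
under eq_Rintegral do rewrite -mulrA -natrM mulnb.
rewrite (expectZ _ (p := predT)); last first.
  by under eq_fun do rewrite -mulnb natrM; exact: determined_comp2.
rewrite (expectZ _ (Hrd a)) -mulrA; congr (_ * _).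
have mA := readout_measurable (J := J) [set a].
have E1 : (fun w => (readout val J w == a)%:R : R) = \1_(readout val J @^-1` [set a]).
  by apply/funext => w; rewrite indicE; congr ((nat_of_bool _)%:R); apply/eqP/idP => [?|]; rewrite inE.
have E2 : (fun w => ((readout val J w == a) && (val i w == x))%:R : R) =
  \1_(readout val J @^-1` [set a] `&` val i @^-1` [set x]).
  apply/funext => w; rewrite indicE; congr ((nat_of_bool _)%:R).
  apply/andP/idP => [[/eqP ? /eqP ?]|]; rewrite inE//=.
  by move=> -[/= -> ->]; rewrite !eqxx.
rewrite E1 E2 !expect_indic//; last exact: measurableI.
by rewrite independent_readout// fineM// fin.
Qed.

End Expectation.

(** * One step of the noisy voter model *)

Section NoisyVoter.
Context (R : realType) (eps : R) (V : finType) (e : rel V).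
Context d (T : measurableType d) (P : probability T R) (M : nvm eps e P).

Local Notation "''E' f" := (Rintegral P setT f) (at level 10, f at level 8).

Definition noise_index : choiceType := (V + (nat * V + (nat * V + nat * V)))%type.

(** All sources of randomness are embedded in the single finite type [bool + V], so that they form
    one family of discrete variables. *)
Definition noise (i : noise_index) (w : T) : bool + V :=
  match i with
  | inl u => inl (nvm_X0 M u w)
  | inr (inl (t, u)) => inl (nvm_xi M t u w)
  | inr (inr (inl (t, u))) => inl (nvm_Y M t u w)
  | inr (inr (inr (t, u))) => inr (nvm_eta M t u w)
  end.

Definition site (i : noise_index) : option (nat * V) :=
  match i with
  | inl _ => None
  | inr (inl s) | inr (inr (inl s)) | inr (inr (inr s)) => Some s
  end.

(** Noise of index [s] produces time [s + 1], so the states at time [t] use the indices [s < t] and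
    the initial values, which have no site and are always included. *)
Definition before (t : nat) : pred noise_index :=
  fun i => if site i is Some (s, _) then (s < t)%N else true.

(** All variables except the three that update [u] from time [t] to time [t + 1]. *)
Definition off (t : nat) (u : V) : pred noise_index :=
  fun i => site i != Some (t, u).

Local Notation det := (determined noise).

Lemma noise_measurable i x : measurable (noise i @^-1` [set x]).
Proof.
have ml (X : {RV P >-> bool}) y : measurable ((fun w => inl (X w) : bool + V) @^-1` [set y]).
  case: y => [b|v].
    rewrite (_ : _ @^-1` _ = X @^-1` [set b]).
      by apply: measurable_funPTI.
    by apply/seteqP; split => w /= => [[]|->].
  by rewrite (_ : _ @^-1` _ = set0)// -subset0 => w.
case: i => [u|[[t u]|[[t u]|[t u]]]]; [exact: ml|exact: ml|exact: ml|].
case: x => [b|v]; first by rewrite (_ : _ @^-1` _ = set0)// -subset0 => w.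
rewrite (_ : _ @^-1` _ = nvm_eta M t u @^-1` [set v]).
  exact: nvm_eta_measurable.
by apply/seteqP; split => w /= => [[]|->].
Qed.

Lemma noise_independent : mutually_independent P (fun i => events_of (noise i)).
Proof.
move=> J A AJ; apply: (nvm_indep (n := M)) => i /AJ.
by case: i => [u|[[t u]|[[t u]|[t u]]]] [B _ <-];
  [exists (inl @^-1` B)|exists (inl @^-1` B)|exists (inl @^-1` B)|exists (inr @^-1` B)].
Qed.

Let indep := expect_indep noise_measurable noise_independent.
Let EB p p' f g := @expectB R d T P _ _ _ noise_measurable p p' f g.
Let ED p p' f g := @expectD R d T P _ _ _ noise_measurable p p' f g.
Let EZ p k f := @expectZ R d T P _ _ _ noise_measurable p k f.

Lemma expect_bernoulli p f i (X : {RV P >-> bool}) (r : R) : 0 <= r <= 1 ->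
  (forall w, noise i w = inl (X w)) -> distribution P X =1 bernoulli_prob r ->
  det p f -> ~~ p i -> 'E (fun w => f w * (X w)%:R) = 'E f * r.
Proof.
move=> r01 iX Xlaw df pi.
have XE w : (X w)%:R = (noise i w == inl true)%:R :> R.
  by rewrite iX; case: (X w).
under eq_Rintegral do rewrite XE.
rewrite (indep (inl true) df pi) (_ : _ @^-1` _ = X @^-1` [set true]).
  by rewrite -[P _]/(distribution P X [set true]) Xlaw /bernoulli_prob r01 fsbig_set1.
by apply/seteqP; split => w /=; rewrite iX; [case|move=> ->].
Qed.

Lemma expect_xi p f t u : 0 <= eps <= 1 -> det p f -> ~~ p (inr (inl (t, u))) ->
  'E (fun w => f w * (nvm_xi M t u w)%:R) = 'E f * eps.
Proof. by move=> eps01; apply: expect_bernoulli => //; exact: nvm_xi_law. Qed.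

Lemma expect_Y p f t u : det p f -> ~~ p (inr (inr (inl (t, u)))) ->
  'E (fun w => f w * (nvm_Y M t u w)%:R) = 'E f * 2^-1.
Proof.
apply: expect_bernoulli => //; last exact: nvm_Y_law.
by apply/andP; split; lra.
Qed.

Lemma expect_eta p f t u v : det p f -> ~~ p (inr (inr (inr (t, u)))) ->
  'E (fun w => f w * (nvm_eta M t u w == v)%:R) =
  'E f * (if e u v then #|e u|%:R^-1 else 0).
Proof.
move=> df pi; rewrite -[if _ then _ else _]/(fine (if e u v then #|e u|%:R^-1 else 0)%:E).
rewrite -(nvm_eta_law M t).
rewrite (_ : nvm_eta M t u @^-1` [set v] = noise (inr (inr (inr (t, u)))) @^-1` [set inr v]).
  by rewrite -(indep (inr v) df pi).
by apply/seteqP; split => w /= => [->|[]].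
Qed.

Lemma determined_xi (p : pred noise_index) t u : p (inr (inl (t, u))) ->
  det p (fun w => (nvm_xi M t u w)%:R : R).
Proof.
move=> pi; have := determined_comp (fun x => (x == inl true)%:R : R)
  (determined_var noise pi).
congr determined; apply/funext => w /=.
by case: (nvm_xi M t u w).
Qed.

Lemma determined_Y (p : pred noise_index) t u : p (inr (inr (inl (t, u)))) ->
  det p (fun w => (nvm_Y M t u w)%:R : R).
Proof.
move=> pi; have := determined_comp (fun x => (x == inl true)%:R : R)
  (determined_var noise pi).
congr determined; apply/funext => w /=.
by case: (nvm_Y M t u w).
Qed.

Lemma determined_eta (p : pred noise_index) t u v : p (inr (inr (inr (t, u)))) ->
  det p (fun w => (nvm_eta M t u w == v)%:R : R).
Proof.
by move=> pi; exact: (determined_comp (fun x => (x == inr v)%:R : R)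
  (determined_var noise pi)).
Qed.

Lemma determined_X0 (p : pred noise_index) u : p (inl u) ->
  det p (fun w => (nvm_X0 M u w)%:R : R).
Proof.
move=> pi; have := determined_comp (fun x => (x == inl true)%:R : R)
  (determined_var noise pi).
congr determined; apply/funext => w /=.
by case: (nvm_X0 M u w).
Qed.

Lemma before_off t s u : (t <= s)%N -> {subset before t <= off s u}.
Proof.
move=> ts i; rewrite !unfold_in /before /off; case: (site i) => // -[s' v] lt.
by apply/eqP => -[ss _]; rewrite ss ltnNge ts in lt.
Qed.

Lemma before_sub s t : (s <= t)%N -> {subset before s <= before t}.
Proof.
move=> st i; rewrite !unfold_in /before; case: (site i) => // -[s' v] lt.
exact: leq_trans lt st.
Qed.

(** The class [p] stays general because two are needed: the past [before t.+1], and [off t u] when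
    the updated site differs from [u]. *)
Lemma determined_stateS (p : pred noise_index) t u :
  (forall i, site i = Some (t, u) -> p i) ->
  (forall v, det p (nvm_state M t v)) -> det p (nvm_state M t.+1 u).
Proof.
move=> pi dX; apply: (determined_comp2 +%R).
  by apply: (determined_comp2 *%R); [apply: determined_xi|apply: determined_Y];
    exact: pi.
apply: (determined_comp2 *%R).
  by apply: (determined_comp (fun x => 1 - x)); apply: determined_xi; exact: pi.
apply: determined_sum => v; apply: (determined_comp2 *%R) => //.
by apply: determined_eta; exact: pi.
Qed.

Lemma determined_state t u : det (before t) (nvm_state M t u).
Proof.
elim: t u => [|t IH] u /=; first exact: determined_X0.
apply: determined_stateS => [i si|v]; first by rewrite /before si ltnSn.
exact: determined_sub (before_sub (leqnSn t)) (IH v).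
Qed.

Definition spin t u w : R := 2 * nvm_state M t u w - 1.

Lemma determined_spin t u : det (before t) (spin t u).
Proof.
by apply: (determined_comp (fun x => 2 * x - 1)); exact: determined_state.
Qed.

(** Distinct sites are updated by distinct variables. In a product of simultaneous spins, the update
    of one site can therefore be averaged while the other spin is kept. *)
Lemma determined_spinS_off t u v : v != u -> det (off t u) (spin t.+1 v).
Proof.
move=> vu; apply: (determined_comp (fun x => 2 * x - 1)).
apply: determined_stateS => [i si|v']; last first.
  exact: determined_sub (before_off u (leqnn t)) (determined_state t v').
by rewrite /off si; apply: contraNneq vu => -[->].
Qed.

Lemma state_bool t u w : exists b : bool, nvm_state M t u w = b%:R.
Proof.
elim: t u => [|t IH] u /=; first by exists (nvm_X0 M u w).
case: (nvm_xi M t u w); first by exists (nvm_Y M t u w); rewrite mul1r subrr mul0r addr0.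
rewrite mul0r add0r subr0 mul1r.
(* The claim is for every outcome, including the null event that [nvm_eta] is not a neighbour; there
   the sum vanishes and the state is 0. *)
have [eue|/negbTE neue] := boolP (e u (nvm_eta M t u w)).
  have [b b_eq] := IH (nvm_eta M t u w); exists b.
  rewrite (bigD1 (nvm_eta M t u w))//= eqxx mul1r b_eq big1 ?addr0// => v /andP[_].
  by rewrite eq_sym => /negbTE ->; rewrite mul0r.
exists false; rewrite big1// => v euv.
by case: eqP euv => [<-|_ _]; [rewrite neue|rewrite mul0r].
Qed.

Lemma spin_sqr t u w : spin t u w * spin t u w = 1.
Proof. by rewrite /spin; have [[] ->] := state_bool t u w; rewrite /=; ring. Qed.

Lemma spin_abs t u w : `|spin t u w| = 1.
Proof.
rewrite /spin; have [[] ->] := state_bool t u w.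
  by rewrite (_ : 2 * _ - 1 = 1) ?normr1//=; rewrite /=; ring.
by rewrite (_ : 2 * _ - 1 = -1) ?normrN1//=; rewrite /=; ring.
Qed.

Lemma state_eq_spin t s u w : (nvm_state M t u w == nvm_state M s u w)%:R =
  (1 + spin t u w * spin s u w) / 2 :> R.
Proof.
rewrite /spin; have [[] ->] := state_bool t u w; have [[] ->] := state_bool s u w;
  rewrite ?eqxx ?oner_eq0 1?[0 == _]eq_sym ?oner_eq0/=; by field.
Qed.

Hypothesis eps01 : 0 <= eps <= 1.
Hypothesis deg_gt0 : forall u, (0 < #|e u|)%N.

Definition nbr_avg (F : V -> R) u : R := #|e u|%:R^-1 * \sum_(v | e u v) F v.

(** The noise updating [u] is independent of [f] and of the states at time [t]. With probability
    [eps] the new spin is a fair sign and contributes 0; otherwise it is the spin of a uniform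
    neighbour. *)
Lemma expect_spinS t u f : det (off t u) f ->
  'E (fun w => f w * spin t.+1 u w) =
  (1 - eps) * nbr_avg (fun v => 'E (fun w => f w * spin t v w)) u.
Proof.
move=> df.
(* Adding [nvm_xi] to the class lets [nvm_Y] or [nvm_eta] be averaged first, and [nvm_xi]
   afterwards. *)
pose p1 i := off t u i || (i == inr (inl (t, u))).
have p1Y : ~~ p1 (inr (inr (inl (t, u)))) by rewrite /p1 /off/= eqxx.
have offxi : ~~ off t u (inr (inl (t, u))) by rewrite /off/= eqxx.
have sub1 : {subset off t u <= p1} by move=> i oi; apply/orP; left.
have dX v : det (off t u) (nvm_state M t v).
  exact: determined_sub (before_off u (leqnn t)) (determined_state t v).
have dfX v : det (off t u) (fun w => f w * nvm_state M t v w).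
  exact: determined_comp2.
have dxi : det p1 (fun w => (nvm_xi M t u w)%:R : R).
  by apply: determined_xi; rewrite /p1 eqxx orbT.
have dfxi : det p1 (fun w => f w * (nvm_xi M t u w)%:R).
  by apply: (determined_comp2 *%R) => //; exact: determined_sub df.
have dfXxi v : det p1 (fun w => f w * nvm_state M t v w * (nvm_xi M t u w)%:R).
  by apply: (determined_comp2 *%R) => //; exact: determined_sub (dfX v).
have toT A p (g : T -> A) : det p g -> det predT g by exact: determined_sub.
have deta v : det predT (fun w => (nvm_eta M t u w == v)%:R : R) by exact: determined_eta.
have dY : det predT (fun w => (nvm_Y M t u w)%:R : R) by exact: determined_Y.
pose g1 w := f w * (nvm_xi M t u w)%:R * (nvm_Y M t u w)%:R.
pose g2 v w := f w * nvm_state M t v w * (nvm_eta M t u w == v)%:R.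
pose g3 v w := f w * nvm_state M t v w * (nvm_xi M t u w)%:R * (nvm_eta M t u w == v)%:R.
have dg1 : det predT g1 by apply: (determined_comp2 *%R) => //; exact: toT dfxi.
have dg2 v : det predT (g2 v) by apply: (determined_comp2 *%R) => //; exact: toT (dfX v).
have dg3 v : det predT (g3 v) by apply: (determined_comp2 *%R) => //; exact: toT (dfXxi v).
have dfT := toT _ _ _ df.
have dZ p (k : R) g : det p g -> det p (fun w => k * g w).
  exact: (determined_comp ( *%R k)).
have dB (g h : T -> R) : det predT g -> det predT h -> det predT (fun w => g w - h w).
  by exact: (determined_comp2 (fun x y => x - y)).
have dD (g h : T -> R) : det predT g -> det predT h -> det predT (fun w => g w + h w).
  by exact: (determined_comp2 +%R).
pose G2 w := \sum_(v | e u v) g2 v w; pose G3 w := \sum_(v | e u v) g3 v w.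
have dG2 : det predT G2 by exact: determined_sum.
have dG3 : det predT G3 by exact: determined_sum.
(* Expand the update into monomials in which each noise variable occurs as a separate factor: [g1]
   comes from the noise, [g2 - g3] from copying. *)
have -> : (fun w => f w * spin t.+1 u w) =
    (fun w => 2 * g1 w + (2 * G2 w - (2 * G3 w + f w))).
  apply/funext => w; rewrite /spin /= /G2 /G3 /g1.
  rewrite (_ : \sum_(v | e u v) g2 v w = f w *
    \sum_(v | e u v) (nvm_eta M t u w == v)%:R * nvm_state M t v w); last first.
    by rewrite mulr_sumr; apply: eq_bigr => v _; rewrite /g2; ring.
  rewrite (_ : \sum_(v | e u v) g3 v w = f w * (nvm_xi M t u w)%:R *
    \sum_(v | e u v) (nvm_eta M t u w == v)%:R * nvm_state M t v w); last first.
    by rewrite mulr_sumr; apply: eq_bigr => v _; rewrite /g3; ring.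
  by ring.
rewrite (ED (dZ _ _ _ dg1) (dB _ _ (dZ _ _ _ dG2) (dD _ _ (dZ _ _ _ dG3) dfT))).
rewrite (EB (dZ _ _ _ dG2) (dD _ _ (dZ _ _ _ dG3) dfT)) (ED (dZ _ _ _ dG3) dfT).
rewrite !(EZ _ dg1, EZ _ dG2, EZ _ dG3) /G2 /G3.
rewrite !(expect_sum P noise_measurable _ _ dg2, expect_sum P noise_measurable _ _ dg3).
rewrite /g1 (expect_Y dfxi p1Y) (expect_xi eps01 df offxi).
under eq_bigr => v euv.
  rewrite /g2 (expect_eta v (dfX v)) ?euv; last by rewrite /off/= eqxx.
  over.
under [in X in _ - (2 * X + _)]eq_bigr => v euv.
  rewrite /g3 (expect_eta v (dfXxi v)) ?euv// (expect_xi eps01 (dfX v) offxi); over.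
have -> : nbr_avg (fun v => 'E (fun w => f w * spin t v w)) u =
    2 * (#|e u|%:R^-1 * \sum_(v | e u v) 'E (fun w => f w * nvm_state M t v w)) - 'E f.
  rewrite /nbr_avg.
  under eq_bigr => v _.
    rewrite (_ : (fun w => _) = fun w => 2 * (f w * nvm_state M t v w) - f w); last first.
      by apply/funext => w; rewrite /spin; ring.
    rewrite (EB (dZ _ _ _ (dfX v)) df) (EZ _ (dfX v)); over.
  rewrite sumrB -mulr_sumr sumr_const -[X in _ * (_ - X)]mulr_natr.
  have n0 : #|e u|%:R != 0 :> R by rewrite pnatr_eq0 -lt0n.
  by rewrite mulrBr mulrCA mulrCA [in X in _ - X]mulrC mulfK.
rewrite -!mulr_suml; move: (#|e u|%:R^-1) => n.
by field.
Qed.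

End NoisyVoter.

(** * Decay of correlations *)

Section Averages.
Context (R : realType) (V : finType) (e : rel V).
Hypothesis deg_gt0 : forall u, (0 < #|e u|)%N.

Local Notation avg := (nbr_avg (R := R) e).

Lemma nbr_avgB F G u : avg (fun v => F v - G v) u = avg F u - avg G u.
Proof. by rewrite /nbr_avg sumrB mulrBr. Qed.

Lemma nbr_avgZ c F u : avg (fun v => c * F v) u = c * avg F u.
Proof. by rewrite /nbr_avg -mulr_sumr mulrCA. Qed.

Lemma nbr_avg_le F B u : (forall v, `|F v| <= B) -> `|avg F u| <= B.
Proof.
move=> FB; have n0 : 0 < #|e u|%:R :> R by rewrite ltr0n.
rewrite normrM ger0_norm ?invr_ge0 ?(ltW n0)// ler_pdivrMl//.
apply: le_trans (ler_norm_sum _ _ _) _; rewrite mulr_natl -sumr_const.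
exact: ler_sum.
Qed.

(** With [K] the limit covariance at equal times, this is the limit of [E[Z_t(v) Z_(t+k)(u)]]: each
    further time step averages over the neighbours of the later site and costs a factor
    [1 - eps]. *)
Fixpoint lagged (eps : R) (K : V -> V -> R) k u v : R :=
  if k is k'.+1 then (1 - eps) * avg (fun u' => lagged eps K k' u' v) u
  else K u v.

End Averages.

(** * Mixing and concentration of the repetition statistic *)

Section Mixing.
Context (R : realType) (eps : R) (V : finType) (e : rel V).
Hypothesis eps01 : 0 < eps < 1.
Hypothesis deg_gt0 : forall u, (0 < #|e u|)%N.

Local Notation avg := (nbr_avg (R := R) e).
Local Notation q := ((1 - eps) ^+ 2).

Context (K : V -> V -> R) (B : R).
Hypothesis K_diag : forall u, K u u = 1.
Hypothesis K_harmonic : forall u v, u != v ->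
  K u v = q * avg (fun u' => avg (fun v' => K u' v') v) u.
Hypothesis K_le : forall u v, `|K u v| <= B.

Context d (T : measurableType d) (P : probability T R) (M : nvm eps e P).

Local Notation "''E' f" := (Rintegral P setT f) (at level 10, f at level 8).
Local Notation det := (determined (noise M)).
Local Notation Z := (spin M).

Let eps01' : 0 <= eps <= 1.
Proof. by case/andP: eps01 => /ltW -> /ltW ->. Qed.

Let q01 : 0 < q < 1.
Proof.
case/andP: eps01 => e0 e1; apply/andP; split; first by rewrite exprn_gt0 ?subr_gt0.
by rewrite expr_lt1// ?subr_ge0 1?ltW// gtrBl.
Qed.

Let B_ge0 (u : V) : 0 <= B.
Proof. exact: le_trans (normr_ge0 _) (K_le u u). Qed.

(** Induction on [n]. On the diagonal both terms equal ['E f], since spins square to 1. Off the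
    diagonal, expectation and kernel obey the same recursion, so their difference is averaged and
    multiplied by [q]. The prefactor is the trivial bound at [n = 0]. *)
Lemma spin_covariance_decay s n u v f A :
  det (before s) f -> (forall w, `|f w| <= A) ->
  `|'E (fun w => f w * Z (s + n) v w * Z (s + n) u w) - 'E f * K u v| <=
  A * (1 + B) * q ^+ n.
Proof.
move=> df fA; have Ef := expect_abs_le P (noise_measurable M) df fA.
have A0 : 0 <= A by exact: le_trans (normr_ge0 _) Ef.
have q0 : 0 <= q by case/andP: q01 => /ltW.
elim: n u v => [|n IH] u v.
  rewrite expr0 mulr1 mulrDr mulr1 addn0.
  apply: le_trans (ler_normB _ _) _; rewrite normrM lerD//.
    apply: (expect_abs_le P (noise_measurable M) (p := before s)) => [|w].
      apply: (determined_comp2 *%R) (determined_spin M s u).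
      exact: (determined_comp2 *%R) df (determined_spin M s v).
    by rewrite !normrM !spin_abs !mulr1.
  exact: ler_pM.
have [->|uv] := eqVneq u v.
  rewrite K_diag mulr1 (_ : (fun w => _) = f); last first.
    by apply/funext => w; rewrite -mulrA spin_sqr mulr1.
  have B1 : 0 <= 1 + B by rewrite addr_ge0 ?(B_ge0 u).
  by rewrite subrr normr0; apply: mulr_ge0; [exact: mulr_ge0|exact: exprn_ge0].
have df' x : det (off (s + n) x) f.
  by apply: determined_sub df; apply: before_off; rewrite leq_addr.
rewrite addnS (expect_spinS eps01' deg_gt0); last first.
  apply: (determined_comp2 *%R) => //.
  by apply: determined_spinS_off; rewrite eq_sym.
(* The later spin at [u] has been replaced by earlier spins at its neighbours [u']; now the update
   of [v] is averaged in the same way. *)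
have E2 u' : 'E (fun w => f w * Z (s + n).+1 v w * Z (s + n) u' w) =
    (1 - eps) * avg (fun v' => 'E (fun w => f w * Z (s + n) v' w * Z (s + n) u' w)) v.
  under eq_Rintegral do rewrite mulrAC.
  rewrite (expect_spinS eps01' deg_gt0); last first.
    apply: (determined_comp2 *%R) => //.
    exact: determined_sub (before_off v (leqnn _)) (determined_spin M _ u').
  congr (_ * nbr_avg _ _ _); apply/funext => v'.
  by apply: eq_Rintegral => w _; rewrite mulrAC.
rewrite (_ : nbr_avg _ _ _ = avg (fun u' => (1 - eps) *
    avg (fun v' => 'E (fun w => f w * Z (s + n) v' w * Z (s + n) u' w)) v) u); last first.
  by congr nbr_avg; apply/funext => u'; exact: E2.
rewrite nbr_avgZ mulrA -expr2 (K_harmonic uv) ['E f * _]mulrCA -mulrBr.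
rewrite -nbr_avgZ -nbr_avgB; under eq_fun do rewrite -nbr_avgZ -nbr_avgB.
rewrite normrM ger0_norm// (exprS _ n) [leRHS]mulrCA ler_wpM2l//.
by apply: nbr_avg_le => // u'; apply: nbr_avg_le => // v'; exact: IH.
Qed.

(** The [k] extra steps average over the later site only. Each contributes a factor [1 - eps],
    bounded here by 1. *)
Lemma lagged_covariance_decay s n k u v f A :
  det (before s) f -> (forall w, `|f w| <= A) ->
  `|'E (fun w => f w * Z (s + n) v w * Z (s + n + k) u w)
    - 'E f * lagged e eps K k u v| <= A * (1 + B) * q ^+ n.
Proof.
move=> df fA; elim: k u => [|k IH] u.
  by rewrite addn0; exact: spin_covariance_decay.
rewrite addnS (expect_spinS eps01' deg_gt0); last first.
  apply: (determined_comp2 *%R).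
    by apply: determined_sub df; apply: before_off; rewrite -addnA leq_addr.
  by apply: determined_sub (determined_spin M _ v); apply: before_off; rewrite leq_addr.
rewrite /= ['E f * _]mulrCA -mulrBr -nbr_avgZ -nbr_avgB normrM.
case/andP: eps01 => e0 e1.
rewrite ger0_norm ?subr_ge0 ?(ltW e1)//.
apply: le_trans (_ : 1 * _ <= _); last first.
  by rewrite mul1r; apply: nbr_avg_le => // u'; exact: IH.
by rewrite ler_wpM2r// gerBl ltW.
Qed.

Lemma repetition_covariance k u : exists2 C : R, 0 <= C & forall i j, (i <= j)%N ->
  `|'E (fun w => (Z i u w * Z (i + k) u w - lagged e eps K k u u) *
                 (Z j u w * Z (j + k) u w - lagged e eps K k u u))| <=
  C * q ^+ (j - i).
Proof.
case/andP: q01 => q0 q1.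
set c := lagged e eps K k u u.
pose A := 1 + `|c|; have A0 : 0 <= A by rewrite addr_ge0.
have B0 := B_ge0 u.
pose W i w := Z i u w * Z (i + k) u w - c.
have W_le i w : `|W i w| <= A.
  by apply: le_trans (ler_normB _ _) _; rewrite normrM !spin_abs mulr1.
have dW i : det (before (i + k)) (W i).
  apply: (determined_comp2 (fun x y => x * y - c)); last exact: determined_spin.
  by apply: determined_sub (determined_spin M i u); apply: before_sub; rewrite leq_addr.
have qk0 : 0 < q ^+ k by exact: exprn_gt0.
exists ((A * (1 + B) + A * A) / q ^+ k) => [|i j ij].
  (* If [i + k <= j], then [W i] belongs to the past of time [j] and the decay over [j - i - k]
     steps applies; dividing the constant by [q ^+ k] makes up for the [k] lost steps. *)
  by rewrite divr_ge0 ?(ltW qk0)// addr_ge0 ?mulr_ge0// addr_ge0.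
have [ikj|jik] := leqP (i + k) j.
  have /= := lagged_covariance_decay (j - (i + k)) k u u (dW i) (W_le i).
  rewrite subnKC// -/c => le1.
  have -> : 'E (fun w => (Z i u w * Z (i + k) u w - c) * (Z j u w * Z (j + k) u w - c)) =
      'E (fun w => W i w * Z j u w * Z (j + k) u w) - 'E (W i) * c.
    have dWT : det predT (W i) by exact: determined_sub (dW i).
    have dZT t : det predT (Z t u) by exact: determined_sub (determined_spin M t u).
    rewrite [_ * c]mulrC -(expectZ P (noise_measurable M) c dWT).
    rewrite -(expectB P (noise_measurable M) (p := predT) (p' := predT)).
    - by apply: eq_Rintegral => w _; rewrite /W; ring.
    - by apply: (determined_comp2 *%R) => //; exact: (determined_comp2 *%R).
    - exact: (determined_comp ( *%R c)).
  apply: le_trans le1 _.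
  rewrite subnDA [leRHS]mulrAC -[leRHS]mulrA mulrC.
  have -> : q ^+ (j - i) / q ^+ k = q ^+ (j - i - k).
    rewrite -[in LHS](subnK (_ : k <= j - i)%N); last lia.
    by rewrite exprD mulfK// gt_eqF.
  rewrite mulrC; apply: ler_wpM2r; first exact/exprn_ge0/ltW.
  by rewrite lerDl mulr_ge0.
have dWij : det predT (fun w => W i w * W j w).
  by apply: (determined_comp2 *%R); [exact: determined_sub (dW i)|exact: determined_sub (dW j)].
(* Overlapping pairs, [j - i < k]: the trivial bound suffices, since [q ^+ (j - i)] is at least
   [q ^+ k]. *)
apply: le_trans (_ : A * A <= _).
  apply: (expect_abs_le P (noise_measurable M) dWij) => w.
  by rewrite normrM ler_pM.
rewrite -mulrA; apply: le_trans (_ : (A * (1 + B) + A * A) * 1 <= _).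
  by rewrite mulr1 lerDr mulr_ge0// addr_ge0.
rewrite ler_wpM2l//; first by rewrite addr_ge0 ?mulr_ge0// addr_ge0.
rewrite mulrC ler_pdivlMr// mul1r; apply: ler_wiXn2l; lia || by rewrite ltW.
Qed.

Lemma repetition_stat_spin k t u w : (k < t)%N ->
  repetition_stat (R := R) k (nvm_obs M u t w) =
  2^-1 + (2 * (t - k)%:R)^-1 * \sum_(1 <= i < (t - k).+1) Z i u w * Z (i + k) u w.
Proof.
move=> kt; have N0 : (t - k)%:R != 0 :> R by rewrite pnatr_eq0; lia.
rewrite /repetition_stat.
have obs i : (i < t.+1)%N -> (nvm_obs M u t w)`_i = nvm_state M i u w.
  move=> it; have := tnth_mktuple (fun i : 'I_t.+1 => nvm_state M i u w) (Ordinal it).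
  by rewrite (tnth_nth 0).
rewrite (eq_big_nat _ _ (F2 := fun i => 2^-1 + 2^-1 * (Z i u w * Z (i + k) u w))).
  rewrite big_split/= -mulr_sumr sumr_const_nat subSS subn0 -[2^-1 *+ _]mulr_natr.
  by field.
move=> i /andP[i1 it]; rewrite !obs; [|lia|lia].
by rewrite state_eq_spin; field.
Qed.

(** The deviation is [(2 * N)^-1] times the sum of the centred products [W i], with [N = t - k].
    That sum has second moment of order [N], so Chebyshev gives a bound of order [1 / N]. *)
Lemma repetition_stat_concentration k u a : 0 < a -> exists C : R,
  forall t, (k < t)%N ->
  (P [set w | (a <= `|repetition_stat (R := R) k (nvm_obs M u t w) -
       (1 + lagged e eps K k u u) / 2|)%R] <= (C / (t - k)%:R)%:E)%E.
Proof.
move=> a0; have [C C0 covC] := repetition_covariance k u.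
case/andP: q01 => q0 q1.
pose W i w := Z i u w * Z (i + k) u w - lagged e eps K k u u.
have dW i : det predT (W i).
  by apply: (determined_comp2 (fun x y => x * y - lagged e eps K k u u));
    exact: determined_sub (determined_spin M _ u).
exists (C * (1 + 2 / (1 - q)) / (4 * a ^+ 2)) => t kt; set N := (t - k)%N.
have N0 : 0 < N%:R :> R by rewrite ltr0n /N; lia.
have -> : [set w | (a <= `|repetition_stat (R := R) k (nvm_obs M u t w) -
       (1 + lagged e eps K k u u) / 2|)%R] =
    [set w | (2 * N%:R * a <= `|\sum_(1 <= i < N.+1) W i w|)%R].
  apply/funext => w /=; congr is_true.
  rewrite repetition_stat_spin// -/N.
  have -> : 2^-1 + (2 * N%:R)^-1 * \sum_(1 <= i < N.+1) Z i u w * Z (i + k) u w -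
     (1 + lagged e eps K k u u) / 2 = (2 * N%:R)^-1 * \sum_(1 <= i < N.+1) W i w.
    rewrite sumrB sumr_const_nat subSS subn0 -[_ *+ N]mulr_natr.
    by field; rewrite gt_eqF.
  rewrite normrM ger0_norm ?invr_ge0 ?mulr_ge0 ?(ltW N0)//.
  by rewrite ler_pdivlMl ?mulr_gt0.
have dS : det predT (fun w => \sum_(1 <= i < N.+1) W i w) by exact: determined_sum.
have Na0 : 0 < 2 * N%:R * a by rewrite !mulr_gt0.
apply: le_trans (chebyshev_determined P (noise_measurable M) dS Na0) _.
rewrite lee_fin ler_pdivrMr ?exprn_gt0//.
have q01' : 0 <= q < 1 by rewrite ltW.
apply: le_trans (second_moment_sum (noise_measurable M) N C0 q01' dW covC) _.
rewrite le_eqVlt; apply/orP; left; apply/eqP.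
by field; rewrite !gt_eqF ?subr_gt0.
Qed.

End Mixing.

(** * From concentration to distinguishability *)

Lemma determined_repetition_stat (R : realType) (eps : R) (V : finType) (e : rel V)
    d (T : measurableType d) (P : probability T R) (M : nvm eps e P) k u t :
  determined (noise M) predT (fun w => repetition_stat (R := R) k (nvm_obs M u t w)).
Proof.
apply: (determined_comp ( *%R _)); apply: determined_sum => i.
have dobs j : determined (noise M) predT (fun w => (nvm_obs M u t w)`_j).
  have [jt|tj] := ltnP j t.+1.
    have : determined (noise M) predT (nvm_state M j u).
      exact: determined_sub (determined_state M j u).
    congr determined; apply/funext => w.
    have := tnth_mktuple (fun i : 'I_t.+1 => nvm_state M i u w) (Ordinal jt).
    by rewrite (tnth_nth 0).
  by under eq_fun do rewrite nth_default ?size_tuple//; exact: determined_cst.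
exact: (determined_comp2 (fun x y => (x == y)%:R)).
Qed.

(* A kernel satisfying [stationary_kernel] is the limit covariance of the
   spins 2X - 1 at equal times. *)
Definition stationary_kernel (R : realType) (eps : R) (V : finType) (e : rel V)
    (K : V -> V -> R) : Prop :=
  (forall u, K u u = 1) /\
  (forall u v, u != v -> K u v =
    (1 - eps) ^+ 2 * nbr_avg e (fun u' => nbr_avg e (fun v' => K u' v') v) u).

(** Each statistic concentrates at its own limit and the limits differ. A union bound over the two
    deviation events suffices, whatever the joint law of the two models. *)
Lemma distinguishable_repetition (R : realType) (eps : R) (k : nat)
    (V1 : finType) (e1 : rel V1) (u1 : V1) (K1 : V1 -> V1 -> R)
    (V2 : finType) (e2 : rel V2) (u2 : V2) (K2 : V2 -> V2 -> R) :
  0 < eps < 1 ->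
  (forall u, (0 < #|e1 u|)%N) -> (forall u, (0 < #|e2 u|)%N) ->
  stationary_kernel eps e1 K1 -> stationary_kernel eps e2 K2 ->
  lagged e1 eps K1 k u1 u1 != lagged e2 eps K2 k u2 u2 ->
  distinguishable eps e1 u1 e2 u2 (@repetition_stat R k).
Proof.
move=> eps01 deg1 deg2 [K1d K1h] [K2d K2h] c12.
have bounded (V : finType) (K : V -> V -> R) : exists B, forall u v, `|K u v| <= B.
  exists (\sum_u \sum_v `|K u v|) => u v.
  rewrite (bigD1 u)//= (bigD1 v)//= -addrA lerDl addr_ge0// ?sumr_ge0// => i _.
  exact: sumr_ge0.
have [B1 K1le] := bounded _ K1; have [B2 K2le] := bounded _ K2.
pose m1 := (1 + lagged e1 eps K1 k u1 u1) / 2.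
pose m2 := (1 + lagged e2 eps K2 k u2 u2) / 2.
(* Half the distance between the limits, so that the open windows of radius [a] around them are
   disjoint. *)
pose a := `|m1 - m2| / 2.
have a0 : 0 < a.
  rewrite divr_gt0// normr_gt0 subr_eq0; apply: contra_neq c12 => m12.
  by move: m12; rewrite /m1 /m2 => /(congr1 (fun x => 2 * x - 1)); lra.
exists (fun=> [set x | `|x - m1| < a]), (fun=> [set x | `|x - m2| < a]); split.
  move=> _; rewrite -subset0 => x /= [x1 x2].
  have : `|m1 - m2| < a + a.
    rewrite (_ : m1 - m2 = (x - m2) - (x - m1)); last by ring.
    by apply: le_lt_trans (ler_normB _ _) _; exact: ltrD.
  by rewrite /a -splitr ltxx.
move=> d T P M1 M2.
have [C1 conc1] := repetition_stat_concentration eps01 deg1 K1d K1h K1le M1 k u1 a0.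
have [C2 conc2] := repetition_stat_concentration eps01 deg2 K2d K2h K2le M2 k u2 a0.
rewrite -/m1 in conc1; rewrite -/m2 in conc2.
pose S1 t w := repetition_stat (R := R) k (nvm_obs M1 u1 t w).
pose S2 t w := repetition_stat (R := R) k (nvm_obs M2 u2 t w).
pose bad1 t := [set w | (a <= `|S1 t w - m1|)%R].
pose bad2 t := [set w | (a <= `|S2 t w - m2|)%R].
have mbad1 t : measurable (bad1 t).
  apply: (determined_measurable (noise_measurable M1) (Q := bad1 t)).
  exact: (determined_comp (fun x => is_true (a <= `|x - m1|))
    (determined_repetition_stat M1 k u1 t)).
have mbad2 t : measurable (bad2 t).
  apply: (determined_measurable (noise_measurable M2) (Q := bad2 t)).
  exact: (determined_comp (fun x => is_true (a <= `|x - m2|))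
    (determined_repetition_stat M2 k u2 t)).
have goodE t : [set w | `|S1 t w - m1| < a /\ `|S2 t w - m2| < a] =
    ~` (bad1 t `|` bad2 t).
  apply/seteqP; split=> w /=; rewrite !ltNge /bad1 /bad2 /=.
    by move=> [/negP b1 /negP b2] [].
  by move=> nb; split; apply/negP => b; apply: nb; [left|right].
apply: (@squeeze_cvge _ _ _ _ (fun t => (1 - (C1 + C2) / (t - k)%:R)%:E) _ (fun=> 1%E)).
- exists k.+1 => // t /= kt; rewrite -[X in P X]/[set w | `|S1 t w - m1| < a /\ `|S2 t w - m2| < a].
  rewrite goodE probability_le1 ?andbT; last exact/measurableC/measurableU.
  rewrite probability_setC; last exact: measurableU.
  rewrite EFinB leeB//; apply: le_trans (measureU2 _ (mbad1 t) (mbad2 t)) _.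
  by rewrite mulrDl EFinD; apply: leeD; [exact: conc1|exact: conc2].
- apply: cvg_EFin; first by near=> t.
  (* After the shift the denominator [t - k] becomes [n + 1], that of the harmonic sequence. *)
  rewrite -(cvg_shiftn k.+1).
  rewrite (_ : (fun n => _) = fun n => 1 - (C1 + C2) * harmonic n); last first.
    by apply/funext => n /=; rewrite /harmonic /=; congr (1 - _ / _%:R); lia.
  have : (fun n => 1 - (C1 + C2) * harmonic n) x @[x --> \oo] --> 1 - (C1 + C2) * 0.
    by apply: cvgB; [exact: cvg_cst|apply: cvgM; [exact: cvg_cst|exact: cvg_harmonic]].
  by rewrite mulr0 subr0.
- exact: cvg_cst.
Unshelve. all: by end_near.
Qed.

(** * Stationary covariance on the cycle *)

Section CycleProfile.
Context (R : realType) (l : R).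
Hypothesis l01 : 0 < l < 1.

Let l_gt0 : 0 < l. Proof. by case/andP: l01. Qed.

Let den_neq0 m : 1 + l ^+ m != 0.
Proof. by rewrite gt_eqF// addr_gt0// exprn_gt0. Qed.

(** For [k <= m], the solution of [x_(k+1) + x_(k-1) = (l + 1/l) x_k] that is symmetric under
    [k -> m - k] and equals 1 at 0; with [h = ln l] it is [cosh((m/2 - k) h) / cosh(m h / 2)]. *)
Definition profile m k : R := (l ^+ k + l ^+ (m - k)) / (1 + l ^+ m).

Definition cyclic_profile m (x : int) : R := profile m `|(x %% m)%Z|%N.

Lemma profile_gt0 m k : 0 < profile m k.
Proof. by rewrite divr_gt0 ?addr_gt0 ?exprn_gt0. Qed.

Lemma profileC m k : (k <= m)%N -> profile m (m - k) = profile m k.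
Proof. by move=> km; rewrite /profile subKn// addrC. Qed.

Lemma profile0 m : profile m 0 = 1.
Proof. by rewrite /profile expr0 subn0 divff. Qed.

Lemma profile_rec m k : (0 < k < m)%N ->
  profile m k.+1 + profile m k.-1 = (l + l^-1) * profile m k.
Proof.
case: k => // k; rewrite /= => km; rewrite /profile.
have -> : (m - k = (m - k.+2).+2)%N by lia.
have -> : (m - k.+1 = (m - k.+2).+1)%N by lia.
by rewrite !exprS; field; rewrite den_neq0 gt_eqF.
Qed.

Lemma profile1_inj a b : (0 < a)%N -> (0 < b)%N ->
  profile a 1 = profile b 1 -> a = b.
Proof.
case: a => // a; case: b => // b _ _.
rewrite /profile !subn1 /= expr1 => /eqP; rewrite eqr_div// => /eqP.
rewrite !exprS => eqab; congr _.+1; apply: (ieexprIn l_gt0).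
  by rewrite lt_eqF//; case/andP: l01.
have l2 : 1 - l * l != 0.
  case/andP: l01 => _ l1; rewrite subr_eq0 gt_eqF// mulr_ilt1//; exact: ltW.
(* The cross-multiplied difference factors as [(l^a - l^b) (1 - l^2)], and the second factor is
   nonzero. *)
apply/eqP; rewrite -subr_eq0 -(inj_eq (mulIf l2)) mul0r; apply/eqP.
have -> : (l ^+ a - l ^+ b) * (1 - l * l) =
  (l + l ^+ a) * (1 + l * l ^+ b) - (l + l ^+ b) * (1 + l * l ^+ a) by ring.
by rewrite eqab subrr.
Qed.

(** The endpoint [k = m] is included, by symmetry of the profile, so that the recursion can step
    from [m - 1] to [m]. *)
Lemma cyclic_profileE m k (z : int) : (0 < m)%N -> (k <= m)%N ->
  cyclic_profile m (z * m%:Z + k%:Z) = profile m k.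
Proof.
move=> m0; rewrite leq_eqVlt => /orP[/eqP ->|km]; rewrite /cyclic_profile modzMDl.
  by rewrite modzz profile0 -profileC// subnn profile0.
by rewrite modz_nat modn_small.
Qed.

Lemma cyclic_profile0 m : cyclic_profile m 0 = 1.
Proof. by rewrite /cyclic_profile mod0z profile0. Qed.

Lemma cyclic_profile_mod m x y : (x = y %[mod m%:Z])%Z ->
  cyclic_profile m x = cyclic_profile m y.
Proof. by rewrite /cyclic_profile => ->. Qed.

Lemma cyclic_profile_rec m x : (0 < m)%N -> ~~ (m%:Z %| x)%Z ->
  cyclic_profile m (x + 1) + cyclic_profile m (x - 1) =
  (l + l^-1) * cyclic_profile m x.
Proof.
move=> m0 ndvd; have mZ : m%:Z != 0 by rewrite eqz_nat -lt0n.
pose k := `|(x %% m)%Z|%N; pose z := (x %/ m)%Z.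
have xk : (x %% m)%Z = k :> int by rewrite /k gez0_abs// modz_ge0.
have km : (k < m)%N by rewrite -ltz_nat -xk ltz_pmod.
have k0 : (0 < k)%N.
  by rewrite lt0n; apply: contraNneq ndvd => k0; apply/dvdz_mod0P; rewrite xk k0.
have xE : x = z * m%:Z + k%:Z by rewrite -xk; exact: divz_eq.
have -> : x + 1 = z * m%:Z + k.+1%:Z by rewrite xE; lia.
have -> : x - 1 = z * m%:Z + k.-1%:Z by rewrite xE; lia.
rewrite [in RHS]xE !cyclic_profileE//; try lia.
by apply: profile_rec; rewrite k0 km.
Qed.

End CycleProfile.

(* The difference of two independent walks on the n-cycle moves by -2, 0 or 2;
   it walks along a cycle of length [stride n]. *)
Definition stride n := if odd n then n else n./2.

Lemma stride_gt1 n : (3 <= n)%N -> (1 < stride n)%N.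
Proof. by rewrite /stride; case: ifP; lia. Qed.

Lemma odd_stride_inj m n : odd m = odd n -> stride m = stride n -> m = n.
Proof. by move=> omn; rewrite /stride omn; case: ifP; lia. Qed.

(** * Covariance kernel of the cycle *)

Section CycleKernel.
Context (R : realType) (eps : R).
Hypothesis eps01 : 0 < eps < 1.

Local Notation q := ((1 - eps) ^+ 2).

(** The root in (0, 1) of [l + 1/l + 2 = 4/q]. *)
Definition killing_root : R :=
  (1 - Num.sqrt (1 - q)) / (1 + Num.sqrt (1 - q)).

Local Notation l := killing_root.

Let q01 : 0 < q < 1.
Proof.
case/andP: eps01 => e0 e1; apply/andP; split; first by rewrite exprn_gt0 ?subr_gt0.
by rewrite expr_lt1// ?subr_ge0 1?ltW// gtrBl.
Qed.

Lemma killing_root01 : 0 < l < 1.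
Proof.
case/andP: q01 => q0 q1; rewrite /killing_root; set s := Num.sqrt _.
have s0 : 0 < s by rewrite sqrtr_gt0 subr_gt0.
have s1 : s < 1 by rewrite -[ltRHS]sqrtr1 ltr_sqrt// gtrBl.
by apply/andP; split; [apply: divr_gt0; lra|rewrite ltr_pdivrMr; lra].
Qed.

Lemma killing_rootE : q * (l + l^-1 + 2) = 4.
Proof.
case/andP: q01 => q0 q1; rewrite /killing_root; set s := Num.sqrt _.
have s0 : 0 < s by rewrite sqrtr_gt0 subr_gt0.
have s1 : s < 1 by rewrite -[ltRHS]sqrtr1 ltr_sqrt// gtrBl.
have -> : q = 1 - s * s by rewrite -expr2 sqr_sqrtr ?subr_ge0 ?(ltW q1)//; ring.
by field; apply/andP; split; lra.
Qed.

(** The profile at [j], where [x = 2j] modulo [n]. For odd [n], 2 is invertible with inverse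
    [(n + 1)/2 = n./2.+1]; for even [n], [j] is defined modulo [n/2] and exists for even [x]
    only. *)
Definition cycle_covariance n (x : int) : R :=
  if odd n then cyclic_profile l n (x * (n./2.+1)%:Z)
  else if (2 %| x)%Z then cyclic_profile l n./2 (x %/ 2)%Z else 0.

Lemma cycle_covariance0 n : cycle_covariance n 0 = 1.
Proof.
rewrite /cycle_covariance mul0r dvdz0 div0z !cyclic_profile0 ?if_same//; exact: killing_root01.
Qed.

Lemma cycle_covariance_mod n x y : (2 < n)%N -> (x = y %[mod n%:Z])%Z ->
  cycle_covariance n x = cycle_covariance n y.
Proof.
move=> n2 /eqP; rewrite eqz_mod_dvd => /dvdzP[z xy]; have {xy}-> : x = y + z * n%:Z by lia.
rewrite /cycle_covariance; case: ifP => [_|on].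
  apply: cyclic_profile_mod.
  by rewrite mulrDl mulrAC addrC modzMDl.
have nE : n%:Z = n./2%:Z * 2 by lia.
have -> : (2 %| y + z * n%:Z)%Z = (2 %| y)%Z by lia.
case: ifP => // y2; apply: cyclic_profile_mod.
have -> : ((y + z * n%:Z) %/ 2)%Z = z * n./2%:Z + (y %/ 2)%Z by lia.
by rewrite modzMDl.
Qed.

Lemma cycle_covariance_rec n x : (2 < n)%N -> ~~ (n%:Z %| x)%Z ->
  cycle_covariance n x = q * (4^-1 *
    (cycle_covariance n (x + 2) + 2 * cycle_covariance n x + cycle_covariance n (x - 2))).
Proof.
move=> n2 nx.
(* By [killing_rootE], the killed average over the moves 2, 0, 0, -2 is equivalent to the recursion
   of the profile in steps of 2. *)
suff rec : cycle_covariance n (x + 2) + cycle_covariance n (x - 2) =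
    (l + l^-1) * cycle_covariance n x.
  rewrite addrAC rec -mulrDl; have := killing_rootE; move: (l + l^-1 + 2) => r qr.
  by rewrite mulrCA mulrA mulrA -[_ * q * r]mulrA qr mulVf ?mul1r// pnatr_eq0.
rewrite /cycle_covariance; case: ifP => on.
  have -> : cyclic_profile l n ((x + 2) * (n./2.+1)%:Z) =
      cyclic_profile l n (x * (n./2.+1)%:Z + 1).
    apply: cyclic_profile_mod.
    have -> : (x + 2) * (n./2.+1)%:Z = 1 * n%:Z + (x * (n./2.+1)%:Z + 1) by lia.
    by rewrite modzMDl.
  have -> : cyclic_profile l n ((x - 2) * (n./2.+1)%:Z) =
      cyclic_profile l n (x * (n./2.+1)%:Z - 1).
    apply: cyclic_profile_mod.
    have -> : (x - 2) * (n./2.+1)%:Z = (- 1) * n%:Z + (x * (n./2.+1)%:Z - 1) by lia.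
    by rewrite modzMDl.
  apply: cyclic_profile_rec; [exact: killing_root01|lia|].
  (* Multiplication by the inverse of 2 preserves non-divisibility by [n]: doubling recovers [x]
     modulo [n]. *)
  apply: contra nx => nx2; have -> : x = 2 * (x * (n./2.+1)%:Z) - x * n%:Z by lia.
  by apply: rpredB; exact: dvdz_mull.
have -> : (2 %| x + 2)%Z = (2 %| x)%Z by lia.
have -> : (2 %| x - 2)%Z = (2 %| x)%Z by lia.
case: ifP => x2; last by rewrite mulr0 addr0.
have -> : ((x + 2) %/ 2)%Z = (x %/ 2)%Z + 1 by lia.
have -> : ((x - 2) %/ 2)%Z = (x %/ 2)%Z - 1 by lia.
apply: cyclic_profile_rec; [exact: killing_root01|lia|].
apply: contra nx => /dvdzP[z xz]; apply/dvdzP; exists z.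
have -> : n%:Z = n./2%:Z * 2 by lia.
by rewrite mulrA -xz divzK.
Qed.

Lemma cycle_covariance2 n : (2 < n)%N ->
  cycle_covariance n 2 = profile l (stride n) 1 /\
  cycle_covariance n (- 2) = profile l (stride n) 1.
Proof.
move=> n2; have := stride_gt1 n2; rewrite /cycle_covariance /stride.
have kr := killing_root01; case: ifP => on s1.
  have -> : 2 * (n./2.+1)%:Z = 1 * n%:Z + 1%N%:Z by lia.
  have -> : - 2 * (n./2.+1)%:Z = - 2 * n%:Z + (n - 1)%N%:Z by lia.
  by rewrite !cyclic_profileE ?profileC//; lia.
rewrite (_ : (2 %/ 2)%Z = 0 * n./2%:Z + 1%N%:Z)//.
rewrite (_ : (- 2 %/ 2)%Z = - 1 * n./2%:Z + (n./2 - 1)%N%:Z); last lia.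
by rewrite !cyclic_profileE ?profileC//; lia.
Qed.

Lemma cycle_covariance1_odd n x : odd n -> 0 < cycle_covariance n x.
Proof. by rewrite /cycle_covariance => ->; exact/profile_gt0/killing_root01. Qed.

Lemma cycle_covariance1_even n : ~~ odd n ->
  cycle_covariance n 1 = 0 /\ cycle_covariance n (- 1) = 0.
Proof. by rewrite /cycle_covariance => /negbTE ->. Qed.

Definition cycle_kernel n (u v : 'I_n) : R := cycle_covariance n (u%:Z - v%:Z).

Lemma nbr_avg_cycle n (F : 'I_n -> R) u : (2 < n)%N ->
  nbr_avg (@cycle_adj n) F u = 2^-1 * (F (ordS u) + F (ord_pred u)).
Proof.
move=> n2; rewrite /nbr_avg cycle_adj_degree//; congr (_ * _).
(* If the two neighbours coincided, the degree would be 1 instead of 2. *)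
have Spred : ord_pred u != ordS u.
  apply: contraPneq (cycle_adj_degree u n2) => predS.
  suff -> : #|cycle_adj u| = #|pred1 (ordS u)| by rewrite card1.
  apply: eq_card => j; rewrite !inE unfold_in /cycle_adj.
  by apply: orb_idr => /eqP uj; rewrite -predS uj ordSK.
rewrite (bigD1 (ordS u)) ?/cycle_adj ?eqxx//=; congr (_ + _).
rewrite (big_pred1 (ord_pred u))// => j /=; rewrite andb_orl andbN/=.
apply/andP/eqP => [[/eqP -> _]|->]; first by rewrite ordSK.
by rewrite ord_predK eqxx.
Qed.

Lemma ordS_mod n (u : 'I_n) : ((ordS u : nat)%:Z = u%:Z + 1 %[mod n%:Z])%Z.
Proof. by rewrite /= -modz_nat modz_mod; congr modz; lia. Qed.

Lemma ord_pred_mod n (u : 'I_n) : ((ord_pred u : nat)%:Z = u%:Z - 1 %[mod n%:Z])%Z.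
Proof.
rewrite /= -modz_nat modz_mod.
have -> : ((u + n).-1)%:Z = 1 * n%:Z + (u%:Z - 1) by have := ltn_ord u; lia.
by rewrite modzMDl.
Qed.

(** Only residues modulo [n] matter, so neighbours can be treated as integer shifts without
    wrap-around cases. *)
Lemma cycle_kernel_shift n (u v u' v' : 'I_n) (a b : int) : (2 < n)%N ->
  (u'%:Z = u%:Z + a %[mod n%:Z])%Z -> (v'%:Z = v%:Z + b %[mod n%:Z])%Z ->
  cycle_kernel u' v' = cycle_covariance n (u%:Z - v%:Z + (a - b)).
Proof.
move=> n2 /eqP; rewrite eqz_mod_dvd => ua /eqP; rewrite eqz_mod_dvd => vb.
apply: cycle_covariance_mod => //; apply/eqP; rewrite eqz_mod_dvd.
have -> : u'%:Z - v'%:Z - (u%:Z - v%:Z + (a - b)) =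
  (u'%:Z - (u%:Z + a)) - (v'%:Z - (v%:Z + b)) by lia.
by rewrite rpredB.
Qed.

Lemma cycle_stationary_kernel n : (2 < n)%N ->
  stationary_kernel eps (@cycle_adj n) (@cycle_kernel n).
Proof.
move=> n2; split=> [u|u v uv].
  by rewrite /cycle_kernel subrr cycle_covariance0.
have ndvd : ~~ (n%:Z %| u%:Z - v%:Z)%Z.
  by apply: contra uv; rewrite -eqz_mod_dvd !modz_nat !modn_small// => /eqP[/val_inj ->].
rewrite [LHS]cycle_covariance_rec//; congr (_ * _).
rewrite !nbr_avg_cycle//.
have S := ordS_mod; have p := ord_pred_mod.
rewrite (cycle_kernel_shift n2 (S _ u) (S _ v)) (cycle_kernel_shift n2 (S _ u) (p _ v)).
rewrite (cycle_kernel_shift n2 (p _ u) (S _ v)) (cycle_kernel_shift n2 (p _ u) (p _ v)).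
rewrite !subrr addr0 opprK (_ : -1 - 1 = - 2 :> int)// (_ : 1 + 1 = 2 :> int)//.
by field.
Qed.

Lemma lagged1_cycle n (u : 'I_n) : (2 < n)%N ->
  lagged (@cycle_adj n) eps (@cycle_kernel n) 1 u u =
  (1 - eps) * (2^-1 * (cycle_covariance n 1 + cycle_covariance n (- 1))).
Proof.
move=> n2; rewrite /= nbr_avg_cycle//.
have u0 : (u%:Z = u%:Z + 0 %[mod n%:Z])%Z by rewrite addr0.
rewrite (cycle_kernel_shift n2 (ordS_mod u) u0) (cycle_kernel_shift n2 (ord_pred_mod u) u0).
by rewrite !subr0 subrr !add0r.
Qed.

(** Of the four two-step paths from [u], two return to [u], where the kernel is 1, and two end at
    distance 2. *)
Lemma lagged2_cycle n (u : 'I_n) : (2 < n)%N ->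
  lagged (@cycle_adj n) eps (@cycle_kernel n) 2 u u =
  q / 2 * (1 + profile l (stride n) 1).
Proof.
move=> n2; rewrite /= !nbr_avg_cycle// ordSK ord_predK.
have u0 : (u%:Z = u%:Z + 0 %[mod n%:Z])%Z by rewrite addr0.
have SS : ((ordS (ordS u) : nat)%:Z = u%:Z + 2 %[mod n%:Z])%Z.
  by rewrite ordS_mod -modzDml ordS_mod modzDml -addrA.
have pp : ((ord_pred (ord_pred u) : nat)%:Z = u%:Z + - 2 %[mod n%:Z])%Z.
  by rewrite ord_pred_mod -modzDml ord_pred_mod modzDml -addrA.
rewrite (cycle_kernel_shift n2 SS u0) (cycle_kernel_shift n2 pp u0) subrr !subr0 !add0r.
have [-> ->] := cycle_covariance2 n2.
by rewrite /cycle_kernel !subrr cycle_covariance0; field.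
Qed.

End CycleKernel.

(** * Comparison of two cycles *)

Theorem theorem1p2 (R : realType) (eps : R) (heps : 0 < eps < 1)
    (n1 n2 : nat) (hn1 : (3 <= n1)%N) (hn2 : (3 <= n2)%N) (hn : n1 <> n2)
    (u1 : 'I_n1) (u2 : 'I_n2) :
  distinguishable eps (@cycle_adj n1) u1 (@cycle_adj n2) u2 (@repetition_stat R 1)
  \/ distinguishable eps (@cycle_adj n1) u1 (@cycle_adj n2) u2 (@repetition_stat R 2).
Proof.
have [e0 e1] := andP heps.
have deg n (n3 : (3 <= n)%N) (u : 'I_n) : (0 < #|cycle_adj u|)%N by rewrite cycle_adj_degree.
have dist k : lagged (@cycle_adj n1) eps (cycle_kernel eps (n := n1)) k u1 u1 !=
    lagged (@cycle_adj n2) eps (cycle_kernel eps (n := n2)) k u2 u2 ->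
    distinguishable eps (@cycle_adj n1) u1 (@cycle_adj n2) u2 (@repetition_stat R k).
  by apply: distinguishable_repetition => //;
    [exact: deg|exact: deg|exact: cycle_stationary_kernel|exact: cycle_stationary_kernel].
have [odd12|odd12] := eqVneq (odd n1) (odd n2).
  (* Equal parity: if the lag 2 limits agreed, the profiles at 1 would agree, hence the strides and
     the lengths. *)
  right; apply: dist; rewrite !lagged2_cycle//.
  have q2 : (1 - eps) ^+ 2 / 2 != 0 by rewrite mulf_neq0 ?invr_eq0// expf_neq0// subr_eq0 gt_eqF.
  apply/eqP => /(mulfI q2) /addrI eqp; apply: hn; apply: odd_stride_inj odd12 _.
  by apply: (profile1_inj (killing_root01 heps) _ _ eqp); exact/ltnW/stride_gt1.
(* Different parity: the lag 1 covariance is positive for the odd cycle and zero for the even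
   one. *)
left; apply: dist; rewrite !lagged1_cycle//.
have e2 : 1 - eps != 0 by rewrite subr_eq0 gt_eqF.
have odd_neq0 n : odd n -> 2^-1 * (cycle_covariance eps n 1 + cycle_covariance eps n (- 1)) != 0.
  by move=> on; rewrite gt_eqF// mulr_gt0// addr_gt0// cycle_covariance1_odd.
have even0 n : ~~ odd n -> 2^-1 * (cycle_covariance eps n 1 + cycle_covariance eps n (- 1)) = 0.
  by move=> /(cycle_covariance1_even eps)[-> ->]; rewrite addr0 mulr0.
apply/eqP => /(mulfI e2) /eqP; apply/negP.
have [h1|h1] := boolP (odd n1).
  by rewrite (even0 n2) ?odd_neq0//; move: odd12; rewrite h1; case: (odd n2).
by rewrite (even0 n1)// eq_sym odd_neq0//; move: odd12; rewrite (negbTE h1); case: (odd n2).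
Qed.
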